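(* There exists an absolute constant $m_0$ such that the following holds for every integer $m\ge m_0$. Let $q=2^m$, let $a,b,c\in\mathbb{F}_{q^3}$, and let $P_2(x)=ax^{q+1}+bx^{q^2+q}+cx^{q^2+1}\in\mathbb{F}_{q^3}[x]$. Then $P_2$ is a planar function on $\mathbb{F}_{q^3}$ if and only if there exist $u,v\in\mathbb{F}_{q^3}$ with $$\Delta:=uv^q+u^{q}v^{q^2}+u^{q^2}v+u^{1+q+q^2}+v^{1+q+q^2}\neq 1$$ such that $$(a,b,c)=\Bigg(\frac{v^q+u^{q+q^2}+u^{q^2}v^{1+q}}{1+\Delta},\ \frac{u^{q^2}v^{q}}{1+\Delta},\ \frac{v^{q+q^2}+u^{q^2}+u^{1+q^2}v^{q}}{1+\Delta}\Bigg).$$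
   Context: A function $f:\mathbb{F}_{2^n}\to\mathbb{F}_{2^n}$ is called planar if for every $a\in\mathbb{F}_{2^n}^{*}$ the map $x\mapsto f(x+a)+f(x)+ax$ is a permutation of $\mathbb{F}_{2^n}$. *)

(* Defs.v *)
From HB Require Import structures.
From mathcomp Require Import all_boot all_order all_algebra all_field.
Set Implicit Arguments. Unset Strict Implicit. Unset Printing Implicit Defensive.
Import GRing.Theory.
Local Open Scope ring_scope.

Definition planar (F : finFieldType) (f : F -> F) : Prop :=
  forall a : F, a != 0 -> bijective (fun x : F => f (x + a) + f x + a * x).

Definition P2 (F : finFieldType) (q : nat) (a b c : F) (x : F) : F :=
  a * x ^+ (q + 1) + b * x ^+ (q ^ 2 + q) + c * x ^+ (q ^ 2 + 1).

Definition Delta (F : finFieldType) (q : nat) (u v : F) : F :=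
  u * v ^+ q + u ^+ q * v ^+ (q ^ 2) + u ^+ (q ^ 2) * v
  + u ^+ (1 + q + q ^ 2) + v ^+ (1 + q + q ^ 2).

(* Main.v *)
Require Import Defs.
From HB Require Import structures.
From mathcomp Require Import all_boot all_order all_algebra all_field.
From mathcomp Require Import ring zify.
Set Implicit Arguments. Unset Strict Implicit. Unset Printing Implicit Defensive.
Import GRing.Theory.
Local Open Scope ring_scope.

(** Write [s] for the [q]-Frobenius and [x * y] for the [F_q]-bilinear product
    polarizing [P2] plus [xy].  Planarity says that [x * y] has no zero
    divisors; through the symmetric matrices of the forms [Tr (w (x * y))] this
    means that a ternary cubic form [G] over [F_q], in which the product of the
    three variables has coefficient [1], has no nontrivial zero.  The parameters
    [u, v] describe the forms [k N (w + u^2 s w + v^2 s (s w))], so one has to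
    show that a cubic form without zeros is a product of three conjugate lines.

    Projecting from a point turns [G] into a pencil of rootless cubics
    [z^3 + p(x) z + r(x)].  Each being cyclic over [F_q], [p^3/r^2 + 1] is of the
    form [u^2 + u] for all [x] in [F_q].  After removing double poles this says
    that [Tr (g(x)/r(x))] vanishes on [F_q] for some [g] of degree at most 3;
    writing the trace as a polynomial multiple of [X^q - X] and differentiating
    forces [g] to be proportional to [r].  Hence [p^3 = h^2 + h r + r^2]
    identically; over the algebraic closure the right-hand side splits into two
    coprime factors, so [p = l1 l2], [r = l1^3 + l2^3] with linear [l1, l2], and
    [l1 + l2] is a linear root of the cubic. *)

(** * Characteristic two and traces of rational functions *)

Lemma pchar2_eq0 (R : nzRingType) : 2%N \in [pchar R] -> (2 : R) = 0.
Proof. exact: pcharf0. Qed.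

Lemma addr_eq0_pchar2 (R : nzRingType) : 2%N \in [pchar R] ->
  forall x y : R, (x + y == 0) = (x == y).
Proof. by move=> R2 x y; rewrite addr_eq0 oppr_pchar2. Qed.

Lemma natr_pchar2 (R : comNzRingType) (R2 : (2 : R) = 0) n :
  n%:R = (if odd n then 1 else 0) :> R.
Proof.
by rewrite -{1}(odd_double_half n) natrD -muln2 natrM R2 mulr0 addr0; case: odd.
Qed.

Lemma oppr_natr_pchar2 (R : comNzRingType) (R2 : (2 : R) = 0) n :
  - n%:R = (if odd n then 1 else 0) :> R.
Proof.
rewrite natr_pchar2 //; case: odd; rewrite ?oppr0 //.
by apply/eqP; rewrite eq_sym -subr_eq0 opprK -[1 + 1]/2%:R R2.
Qed.

(* [ring: H] only replaces the very coefficients listed in its hypotheses, so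
   knowing [2 = 0] is not enough for it to reduce [6] or [-1]. *)
Ltac ring_char2 R2 :=
  ring: R2 (natr_pchar2 R2 3) (natr_pchar2 R2 4) (natr_pchar2 R2 5)
    (natr_pchar2 R2 6) (natr_pchar2 R2 7) (natr_pchar2 R2 8)
    (natr_pchar2 R2 9) (natr_pchar2 R2 10) (natr_pchar2 R2 11) (natr_pchar2 R2 12)
    (oppr_natr_pchar2 R2 1) (oppr_natr_pchar2 R2 2) (oppr_natr_pchar2 R2 3)
    (oppr_natr_pchar2 R2 4) (oppr_natr_pchar2 R2 5) (oppr_natr_pchar2 R2 6).

Lemma exprD_pow2 (R : comNzRingType) (x y : R) n : 2%N \in [pchar R] ->
  (x + y) ^+ (2 ^ n) = x ^+ (2 ^ n) + y ^+ (2 ^ n).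
Proof. by move=> R2; rewrite exprDn_pchar // pnatX pnatE // R2. Qed.

Lemma expr_pow2_inj (R : idomainType) n : 2%N \in [pchar R] ->
  injective (fun x : R => x ^+ (2 ^ n)).
Proof.
move=> R2 x y /= eq_xy; have: (x + y) ^+ (2 ^ n) == 0.
  by rewrite exprD_pow2 // eq_xy addrr_pchar2.
by rewrite expf_eq0 -{1}(oppr_pchar2 R2 y) subr_eq0 => /andP[_ /eqP].
Qed.

Lemma sqrt_pchar2 (K : finFieldType) (x : K) : 2%N \in [pchar K] ->
  exists y, x = y ^+ 2.
Proof.
move=> K2; have [g _ gK] := injF_bij (@expr_pow2_inj K 1 K2).
by exists (g x); rewrite -[LHS]gK expn1.
Qed.

Lemma telescope_pchar2 (R : comNzRingType) (v : R) k : 2%N \in [pchar R] ->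
  \sum_(i < k) (v ^+ 2 + v) ^+ (2 ^ i) = v ^+ (2 ^ k) + v.
Proof.
move=> R2; elim: k => [|k IHk]; first by rewrite big_ord0 expr1 addrr_pchar2.
rewrite big_ord_recr /= IHk exprD_pow2 // -exprM -expnS.
by rewrite addrC -addrA addrA addrA -[_ + v ^+ _ + v ^+ _]addrA addrr_pchar2 ?addr0.
Qed.

Lemma size_polyD_leq (R : nzRingType) (p q : {poly R}) k :
  (size p <= k)%N -> (size q <= k)%N -> (size (p + q)%R <= k)%N.
Proof.
by move=> sz_p sz_q; rewrite (leq_trans (size_polyD _ _)) // geq_max sz_p.
Qed.

Section PolyChar2.
Variable K : finFieldType.
Hypothesis K2 : 2%N \in [pchar K].

Lemma pchar2_poly : 2%N \in [pchar {poly K}].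
Proof. by rewrite pchar_poly. Qed.

Let P2 : (2 : {poly K}) = 0 := pchar2_eq0 pchar2_poly.

Lemma poly_even_odd (g : {poly K}) : exists a b, g = a ^+ 2 + 'X * b ^+ 2.
Proof.
elim/poly_ind: g => [|g c [a [b ->]]].
  by exists 0, 0; rewrite expr0n /= mulr0 addr0.
have [d ->] := sqrt_pchar2 c K2; exists ('X * b + d%:P), a.
by rewrite rmorphXn; ring_char2 P2.
Qed.

Lemma deriv_eq0_sqr (g : {poly K}) : g^`() = 0 -> exists a, g = a ^+ 2.
Proof.
have [a [b ->]] := poly_even_odd g; exists a; move: H.
rewrite derivD derivM derivX !deriv_exp /= -[_ *+ 2]mulr_natl P2.
rewrite -[_ *+ 2 in X in _ + (_ + X)]mulr_natl P2 !mul0r mulr0 !addr0 mul1r add0r.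
by move/eqP; rewrite expf_eq0 /= => /eqP->; rewrite expr0n /= mulr0 addr0.
Qed.

Lemma derivX2 (g : {poly K}) k : ~~ odd k -> (g ^+ k)^`() = 0.
Proof.
move=> k_even; rewrite deriv_exp -(odd_double_half k) (negPf k_even) add0n.
by rewrite -muln2 mulrnA -mulr_natl P2 mul0r.
Qed.

Lemma derivn2_eq0 (g : {poly K}) : g^`()^`() = 0.
Proof.
apply/polyP=> i; rewrite !coef_deriv coef0 -mulrnA.
have: ~~ odd (i.+2 * i.+1) by rewrite oddM /=; case: odd.
rewrite -dvdn2 => /dvdnP[j ->]; rewrite mulrnA -mulr_natl.
by rewrite (pchar2_eq0 K2) mul0r.
Qed.

Lemma poly_fixed_dvdp (g : {poly K}) : (forall x, g.[x] = 0) -> 'X^#|K| - 'X %| g.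
Proof.
move=> g0; rewrite finField_genPoly -big_enum /=.
rewrite uniq_roots_dvdp //; first by apply/allP => x _; apply/rootP.
by rewrite uniq_rootsE enum_uniq.
Qed.

Lemma size_sqr_leq (g : {poly K}) k : (size (g ^+ 2) <= k.*2)%N -> (size g <= k)%N.
Proof.
have [->|] := eqVneq g 0; first by rewrite size_poly0.
move=> nz_g; have: (0 < size (g ^+ 2))%N by rewrite size_poly_gt0 expf_neq0.
have e : (size (g ^+ 2)).-1 = ((size g).-1 * 2)%N := size_exp g 2.
lia.
Qed.

Lemma irredp_coprimep (p g : {poly K}) :
  irreducible_poly p -> coprimep p g = ~~ (p %| g).
Proof.
move=> irr_p; apply/idP/idP => [cop|]; last first.
  apply: contraR => /(irr_p.2 _)/(_ (dvdp_gcdl _ _)) eq_gp.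
  by rewrite -(eqp_dvdl _ eq_gp) dvdp_gcdr.
apply/negP => /dvdp_gcd_idl/eqp_size eq_sz.
by move: irr_p.1; rewrite -eq_sz (eqP cop).
Qed.

(** * Fractions with an irreducible cubic denominator whose trace vanishes on [K] *)

Section CubicDenominator.
Variables (n : nat) (r : {poly K}).
Hypothesis cardK : #|K| = (2 ^ n.+2)%N.
Hypothesis n_gt1 : (1 < n)%N.
Hypothesis sz_r : size r = 4.
Hypothesis r_neq0 : forall x, r.[x] != 0.

Lemma cubic_irr : irreducible_poly r.
Proof. by apply: cubic_irreducible => [|x]; rewrite ?sz_r ?rootE. Qed.

Lemma cubic_coprime (g : {poly K}) : g != 0 -> (size g < 4)%N -> coprimep r g.
Proof.
move=> g0 sz_g; rewrite irredp_coprimep; last exact: cubic_irr.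
by apply/negP=> /(dvdp_leq g0); rewrite sz_r leqNgt sz_g.
Qed.

(** If [s/r] takes values [v^2 + v], its absolute trace telescopes to [v^|K| + v = 0]. Clearing the
    denominator [r^(2^(n+1))] leaves a polynomial that vanishes on [K]. *)
Lemma trace_form_vanish (s : {poly K}) :
  (size s <= 4)%N -> (forall x, exists v, s.[x] = (v ^+ 2 + v) * r.[x]) ->
  exists2 E : {poly K}, (size E <= (2 ^ n).*2.+1)%N &
  \sum_(i < n.+2) s ^+ (2 ^ i) * r ^+ ((2 ^ n).*2 - 2 ^ i) = ('X^#|K| - 'X) * E.
Proof.
move=> sz_s s_tr; set T := \sum_(i < n.+2) _.
have le_i (i : 'I_n.+2) : (2 ^ i <= (2 ^ n).*2)%N.
  by rewrite -mul2n -expnS leq_exp2l // -ltnS.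
have T0 x : T.[x] = 0.
  have [v sx] := s_tr x.
  have -> : T.[x] = r.[x] ^+ (2 ^ n).*2 * \sum_(i < n.+2) (v ^+ 2 + v) ^+ (2 ^ i).
    rewrite mulr_sumr horner_sum; apply: eq_bigr => i _.
    by rewrite hornerM !horner_exp sx exprMn mulrAC -mulrA -exprD subnK // mulrC.
  by rewrite telescope_pchar2 // -cardK expf_card addrr_pchar2 // mulr0.
have /dvdpP[E defT] := poly_fixed_dvdp T0; exists E; last by rewrite defT mulrC.
have szT : (size T <= (2 ^ n).*2 * 3 + 1)%N.
  apply: leq_trans (size_sum _ _ _) _; apply/bigmax_leqP=> i _.
  apply: leq_trans (size_polyMleq _ _) _.
  have ss : (size (s ^+ (2 ^ i)) <= ((size s).-1 * 2 ^ i).+1)%N.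
    exact: size_poly_exp_leq.
  have : (size (r ^+ ((2 ^ n).*2 - 2 ^ i)) <=
          ((size r).-1 * ((2 ^ n).*2 - 2 ^ i)).+1)%N by exact: size_poly_exp_leq.
  have := le_i i; rewrite sz_r; move: sz_s ss; nia.
have [->|E0] := eqVneq E 0; first by rewrite size_poly0.
have szX : size ('X^#|K| - 'X : {poly K}) = (2 ^ n * 4).+1.
  rewrite size_polyDl ?size_polyXn ?size_polyN ?size_polyX cardK.
    by rewrite !expnS; lia.
  by rewrite ltnS !expnS; have := expn_gt0 2 n; lia.
have nzX : 'X^#|K| - 'X != 0 :> {poly K} by rewrite -size_poly_gt0 szX.
have szM : size (E * ('X^#|K| - 'X)) = (size E + size ('X^#|K| - 'X : {poly K})%R).-1.
  exact: size_mul.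
by move: szT; rewrite defT szM szX; move: (size E) => e; lia.
Qed.

(* Differentiating the identity of [trace_form_vanish] kills every summand but
   the first and leaves a polynomial of the shape [E0 + X^q E'], all of whose
   terms are squares. *)
Lemma trace_form_wronskian (s : {poly K}) :
  (size s <= 4)%N -> (forall x, exists v, s.[x] = (v ^+ 2 + v) * r.[x]) ->
  (s * r)^`() = 0.
Proof.
move=> sz_s s_tr; have [E szE defT] := trace_form_vanish sz_s s_tr.
set Q := (2 ^ n)%N in szE defT.
have Q_ge4 : (4 <= Q)%N by rewrite -[4%N]/(2 ^ 2)%N leq_exp2l.
have XE : 'X^#|K| = 'X^(Q.*2) ^+ 2 :> {poly K}.
  by rewrite -exprM cardK !expnS /Q; congr (_ ^+ _); lia.
have dXE : ('X^#|K| - 'X : {poly K})^`() = 1.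
  by rewrite XE derivB derivX derivX2 // sub0r (oppr_pchar2 pchar2_poly).
have dT : (\sum_(i < n.+2) s ^+ (2 ^ i) * r ^+ (Q.*2 - 2 ^ i))^`()
          = (s * r)^`() * r ^+ (Q.*2 - 2).
  rewrite big_ord_recl derivD /= expn0 raddf_sum /= big1 ?addr0 => [|i _].
    have -> : (Q.*2 - 1 = (Q.*2 - 2).+1)%N by lia.
    have even_exp : ~~ odd (Q.*2 - 2) by lia.
    by rewrite expr1 exprS mulrA derivM derivX2 // mulr0 addr0.
  have even_i : ~~ odd (2 ^ bump 0 i) by rewrite /bump add1n expnS; lia.
  have even_r : ~~ odd (Q.*2 - 2 ^ bump 0 i) by lia.
  by rewrite derivM !derivX2 // mul0r mulr0 addr0.
have [E0 [w [B [defE0 defW defB]]]] : exists E0 w B : {poly K},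
    [/\ E + 'X * E^`() = E0 ^+ 2, (s * r)^`() = w ^+ 2 & E^`() = B ^+ 2].
  have [w eq_w] := deriv_eq0_sqr (derivn2_eq0 (s * r)).
  have [B eq_B] := deriv_eq0_sqr (derivn2_eq0 E).
  have [E0 eq_E0] : exists E0 : {poly K}, E + 'X * E^`() = E0 ^+ 2.
    apply: deriv_eq0_sqr; rewrite derivD derivM derivX derivn2_eq0.
    by rewrite mulr0 addr0 mul1r (addrr_pchar2 pchar2_poly).
  by exists E0, w, B.
have sz_dE : (size E^`() <= Q.*2)%N.
  have [->|nz_E] := eqVneq E 0; first by rewrite deriv0 size_poly0.
  have : (size E^`() < size E)%N := lt_size_deriv nz_E; lia.
have sz_E0 : (size E0 <= Q.+1)%N.
  apply: size_sqr_leq; rewrite -defE0; apply: leq_trans (size_polyD _ _) _.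
  rewrite geq_max; apply/andP; split; first by lia.
  apply: leq_trans (size_polyMleq _ _) _; rewrite size_polyX; lia.
have sz_B : (size B <= Q)%N by apply: size_sqr_leq; rewrite -defB.
have sz_w : (size w <= 3)%N.
  apply: size_sqr_leq; rewrite -defW.
  have [->|nz_sr] := eqVneq (s * r) 0; first by rewrite deriv0 size_poly0.
  have : (size (s * r)^`() < size (s * r)%R)%N := lt_size_deriv nz_sr.
  have : (size (s * r)%R <= (size s + size r).-1)%N := size_polyMleq s r.
  rewrite sz_r; lia.
(* Differentiation gives [w^2 r^(2Q-2) = E0^2 + X^(4Q) B^2]; take square roots. *)
have key : w * r ^+ Q.-1 = E0 + 'X^(Q.*2) * B.
  apply: (@expr_pow2_inj _ 1 pchar2_poly); rewrite /= expn1.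
  rewrite (@exprD_pow2 _ _ _ 1 pchar2_poly) expn1 !exprMn -defW -defE0 -defB -XE -exprM.
  have -> : (Q.-1 * 2 = Q.*2 - 2)%N by lia.
  rewrite -dT defT derivM dXE mul1r (oppr_pchar2 pchar2_poly) mulrDl.
  by rewrite addrA addrAC.
(* After multiplication by [r], the identity splits at degree [2Q], because
   [r^Q = lo^Q + X^(2Q) hi^Q]. *)
pose lo := take_poly 2 r; pose hi := drop_poly 2 r.
have rE : r ^+ Q = lo ^+ Q + 'X^(Q.*2) * hi ^+ Q.
  rewrite -{1}(poly_take_drop 2 r) exprD_pow2 ?pchar2_poly //.
  by rewrite exprMn -exprM mul2n [drop_poly _ _ ^+ _ * _]mulrC.
have sz_lo : (size lo <= 2)%N by apply: size_take_poly.
have sz_hi : size hi = 2 by rewrite size_drop_poly sz_r.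
have key2 : (E0 * r + w * lo ^+ Q) = (B * r + w * hi ^+ Q) * 'X^(Q.*2).
  have : (w * r ^+ Q.-1) * r = (E0 + 'X^(Q.*2) * B) * r by rewrite key.
  rewrite -mulrA -exprSr prednK ?rE; last by lia.
  move/(congr1 (fun g => g + E0 * r + 'X^(Q.*2) * (w * hi ^+ Q))) => eq2.
  have -> : E0 * r + w * lo ^+ Q = w * (lo ^+ Q + 'X^(Q.*2) * hi ^+ Q) + E0 * r
    + 'X^(Q.*2) * (w * hi ^+ Q) by ring_char2 P2.
  by rewrite eq2; ring_char2 P2.
(* Here [Q >= 4] enters: [E0 * r] has size at most [Q + 4]. The left side of [key2] is then too
   short to be a nonzero multiple of [X^(2Q)]. *)
have lhs0 : (size (E0 * r + w * lo ^+ Q)%R <= Q.*2)%N.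
  apply: leq_trans (size_polyD _ _) _; rewrite geq_max; apply/andP; split.
    apply: leq_trans (size_polyMleq _ _) _; rewrite sz_r; lia.
  apply: leq_trans (size_polyMleq _ _) _.
  have : (size (lo ^+ Q) <= ((size lo).-1 * Q).+1)%N := size_poly_exp_leq lo Q.
  nia.
have {key2} : B * r + w * hi ^+ Q = 0.
  apply/eqP/negPn/negP => nz; move: lhs0; rewrite key2 size_mulXn //.
  by move: nz; rewrite -size_poly_gt0; lia.
move/eqP; rewrite addr_eq0 (oppr_pchar2 pchar2_poly) => /eqP eq_wh.
rewrite defW; have [->|nz_w] := eqVneq w 0; first by rewrite expr0n.
have nz_hi : hi != 0 by rewrite -size_poly_gt0 sz_hi.
(* By [eq_wh], [r] divides [w * hi^Q], although [w] and [hi] are nonzero of degree below 3. *)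
have: coprimep r (w * hi ^+ Q).
  by rewrite coprimepMr coprimep_expr ?cubic_coprime ?sz_hi.
by rewrite (irredp_coprimep _ cubic_irr) -eq_wh dvdp_mulIr.
Qed.

(** Having zero derivative, [s * r] is a square; the irreducible [r] divides its root, hence [r]
    divides [s], and the degrees leave a constant quotient. *)
Lemma trace_form_multiple (s : {poly K}) :
  (size s <= 4)%N -> (forall x, exists v, s.[x] = (v ^+ 2 + v) * r.[x]) ->
  exists c, s = c *: r.
Proof.
move=> sz_s s_tr; have [d eq_d] := deriv_eq0_sqr (trace_form_wronskian sz_s s_tr).
have irr_r := cubic_irr; have nz_r := irredp_neq0 irr_r.
have r_d : r %| d.
  apply: contraT; rewrite -irredp_coprimep // => /(coprimep_expr 2).
  by rewrite irredp_coprimep // -eq_d dvdp_mulIr.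
have /dvdpP[t st] : r %| s.
  by rewrite -(dvdp_mul2r _ _ nz_r) eq_d; apply: dvdp_mul.
exists t`_0; rewrite st; have [->|nz_t] := eqVneq t 0; first by rewrite mul0r coef0 scale0r.
have szM : size (t * r) = (size t + size r).-1 by exact: size_mul.
have : (size t <= 1)%N by move: sz_s; rewrite st szM sz_r; move: (size t) => e; lia.
by move/size1_polyC => {1}->; rewrite mul_polyC.
Qed.

End CubicDenominator.

End PolyChar2.

(** * Rootless cubics *)

(** [X^|K| - X] already splits over [K], so [L] holds no further roots. *)
Lemma fixed_in_image (K : finFieldType) (L : fieldType) (j : {rmorphism K -> L})
  (y : L) : y ^+ #|K| = y -> exists k, y = j k.
Proof.
move=> yq; have := congr1 (fun g => (map_poly j g).[y]) (finField_genPoly K).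
rewrite rmorphB /= map_polyXn map_polyX hornerD hornerN hornerXn hornerX yq subrr.
rewrite rmorph_prod horner_prod => /esym/eqP/prodf_eq0[k _].
by rewrite rmorphB /= map_polyX map_polyC hornerXsubC subr_eq0 => /eqP; exists k.
Qed.

Section CubicRoots.
Variables (K : finFieldType) (L : fieldType) (j : {rmorphism K -> L}) (m : nat).
Hypothesis cardK : #|K| = (2 ^ m)%N.

Lemma card_pchar2 : 2%N \in [pchar K].
Proof. exact: card_finPcharP cardK _. Qed.

Lemma image_pchar2 : 2%N \in [pchar L].
Proof. by rewrite (fmorph_pchar j) card_pchar2. Qed.

Let L2 := pchar2_eq0 image_pchar2.

Lemma image_expr_card k : j k ^+ #|K| = j k.
Proof. by rewrite -rmorphXn expf_card. Qed.

Lemma exprD_card (x y : L) : (x + y) ^+ #|K| = x ^+ #|K| + y ^+ #|K|.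
Proof. by rewrite cardK exprD_pow2 // image_pchar2. Qed.

Variables p r : K.
Hypothesis no_root : forall k, k ^+ 3 + p * k + r != 0.

(** Frobenius moves every root, since a fixed one would lie in [K]. It therefore cycles the three
    roots, the third being [z + z1] because the cubic has no square term. *)
Lemma rootless_cubic_roots (z : L) : z ^+ 3 + j p * z + j r = 0 ->
  let z1 := z ^+ #|K| in
  [/\ z1 ^+ #|K| = z + z1, z1 ^+ #|K| ^+ #|K| = z,
      j p = z ^+ 2 + z * z1 + z1 ^+ 2 & j r = z * z1 * (z + z1)].
Proof.
move=> rt_z z1.
have conj_root (y : L) : y ^+ 3 + j p * y + j r = 0 ->
    (y ^+ #|K|) ^+ 3 + j p * y ^+ #|K| + j r = 0.
  move/(congr1 (fun u => u ^+ #|K|)); rewrite !exprD_card [(j p * y) ^+ _]exprMn !image_expr_card.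
  by rewrite exprAC expr0n cardK expn_eq0.
have nK (y : L) : y ^+ 3 + j p * y + j r = 0 -> y ^+ #|K| != y.
  move=> rt_y; apply/eqP => /(@fixed_in_image _ _ j)[k def_y].
  have := no_root k; rewrite -(fmorph_eq0 j) !rmorphD !rmorphM /=.
  by rewrite -def_y -!expr2 -exprS rt_y eqxx.
have rt_z1 := conj_root _ rt_z; have rt_z2 := conj_root _ rt_z1.
rewrite -/z1 in rt_z1 rt_z2.
have quad (x y : L) : x ^+ 3 + j p * x + j r = 0 -> y ^+ 3 + j p * y + j r = 0 ->
    x != y -> j p = x ^+ 2 + x * y + y ^+ 2.
  move=> rt_x rt_y; rewrite -(addr_eq0_pchar2 image_pchar2) => nz.
  apply: (mulfI nz); apply/eqP; rewrite -(addr_eq0_pchar2 image_pchar2).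
  rewrite -[0](addr0 (0 : L)) -{1}rt_x -rt_y; apply/eqP; ring_char2 L2.
have zz1 : z != z1 by rewrite eq_sym; apply: nK.
have z1z2 : z1 != z1 ^+ #|K| by rewrite eq_sym; apply: nK.
have def_p := quad _ _ rt_z rt_z1 zz1.
have def_r : j r = z * z1 * (z + z1).
  apply/eqP; rewrite -(addr_eq0_pchar2 image_pchar2) -rt_z def_p.
  by apply/eqP; ring_char2 L2.
have z2E : z1 ^+ #|K| = z + z1.
  have := quad _ _ rt_z1 rt_z2 z1z2; rewrite def_p.
  set z2 := z1 ^+ #|K| => /eqP; rewrite -(addr_eq0_pchar2 image_pchar2).
  have -> : z ^+ 2 + z * z1 + z1 ^+ 2 + (z1 ^+ 2 + z1 * z2 + z2 ^+ 2)
            = (z2 + z) * (z2 + z + z1) by ring_char2 L2.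
  rewrite mulf_eq0 => /orP[] /eqP eq0; last first.
    by apply/eqP; rewrite -(addr_eq0_pchar2 image_pchar2) addrA eq0.
  (* If Frobenius swapped [z] and [z1], it would fix the third root [z + z1]. *)
  have z2z : z2 = z by apply/eqP; rewrite -(addr_eq0_pchar2 image_pchar2) eq0.
  have fix_zz1 : (z + z1) ^+ #|K| = z + z1 by rewrite exprD_card -/z1 -/z2 z2z addrC.
  have /negP[] := nK (z + z1) ltac:(rewrite def_p def_r; ring_char2 L2).
  by rewrite fix_zz1.
split=> //; rewrite z2E exprD_card -/z1 z2E.
by rewrite addrC -addrA (addrr_pchar2 image_pchar2) addr0.
Qed.

End CubicRoots.

Lemma closed_cubic_root (L : closedFieldType) (p r : L) :
  exists z, z ^+ 3 + p * z + r = 0.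
Proof.
have [z] := @GRing.solve_monicpoly L 3 (nth 0 [:: - r; - p]) isT.
rewrite !big_ord_recl big_ord0 /= => eq_z; exists z; rewrite eq_z; ring.
Qed.

(** The cyclic sum [t = z^2 z1 + z1^2 z2 + z2^2 z] is a root of the quadratic resolvent
    [t^2 + r t + p^3 + r^2]. Frobenius cycles the roots and so fixes [t]; then [u = t / r]. *)
Lemma rootless_cubic_artin_schreier (K : finFieldType) m (p r : K) :
  #|K| = (2 ^ m)%N -> (forall k, k ^+ 3 + p * k + r != 0) ->
  exists u, (u ^+ 2 + u) * r ^+ 2 = p ^+ 3 + r ^+ 2.
Proof.
move=> cardK no_root.
have [L [j _]] := countable_algebraic_closure K.
have [z rt_z] := closed_cubic_root (j p) (j r).
have L2 := pchar2_eq0 (image_pchar2 j cardK).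
have [] := rootless_cubic_roots cardK no_root rt_z.
set z1 := z ^+ _ => z2E z3E def_p def_r.
have [|t def_t] := @fixed_in_image K L j (z ^+ 3 + z ^+ 2 * z1 + z1 ^+ 3).
  rewrite !(exprD_card j cardK) [(z ^+ 2 * z1) ^+ _]exprMn.
  rewrite [z ^+ 3 ^+ _]exprAC [z ^+ 2 ^+ _]exprAC [z1 ^+ 3 ^+ _]exprAC -/z1 z2E.
  ring_char2 L2.
have nz_r : r != 0 by have := no_root 0; rewrite expr0n mulr0 !add0r.
exists (t / r); have -> : ((t / r) ^+ 2 + t / r) * r ^+ 2 = t ^+ 2 + t * r by field.
apply: (fmorph_inj j); rewrite !rmorphD !rmorphXn rmorphM /= -def_t def_p def_r.
ring_char2 L2.
Qed.

(** * The quadratic resolvent of a pencil of rootless cubics *)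

Section CubicPencil.
Variables (K : finFieldType) (n : nat) (p r : {poly K}).
Hypothesis cardK : #|K| = (2 ^ n.+2)%N.
Hypothesis n_gt1 : (1 < n)%N.
Hypothesis sz_p : (size p <= 3)%N.
Hypothesis sz_r : size r = 4.
Hypothesis no_root : forall x k, k ^+ 3 + p.[x] * k + r.[x] != 0.

Let K2 : 2%N \in [pchar K] := card_pchar2 cardK.
Let P2 : (2 : {poly K}) = 0 := pchar2_eq0 (pchar2_poly K2).
Let F2 : (2 : K) = 0 := pchar2_eq0 K2.

Lemma pencil_constant_neq0 x : r.[x] != 0.
Proof. by have := no_root x 0; rewrite expr0n mulr0 !add0r. Qed.

Lemma deriv_even_odd (a b : {poly K}) : (a ^+ 2 + 'X * b ^+ 2)^`() = b ^+ 2.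
Proof. by rewrite derivD derivM derivX !derivX2 // mulr0 addr0 mul1r add0r. Qed.

(* Writing [r = E^2 + X O^2], the class of [E / O] is a square root of [X]
   modulo [r]. *)
Lemma sqrt_modp (g : {poly K}) : exists h k, g = h ^+ 2 + r * k.
Proof.
have [E [O def_r]] := poly_even_odd K2 r.
have dr : r^`() = O ^+ 2 by rewrite def_r deriv_even_odd.
have nz_O : O != 0.
  apply/eqP => O0; have szE : (size (E ^+ 2)).-1 = ((size E).-1 * 2)%N := size_exp E 2.
  have rE : r = E ^+ 2 by rewrite def_r O0 expr0n mulr0 addr0.
  by move: szE; rewrite -rE sz_r; lia.
have sz_O : (size O < 4)%N.
  rewrite ltnS (leq_trans _ (leqnSn 2)) // size_sqr_leq // -dr.
  have nz_r : r != 0 by rewrite -size_poly_gt0 sz_r.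
  by apply: leq_trans (ltnW (lt_size_deriv nz_r)) _; rewrite sz_r.
have := cubic_coprime sz_r pencil_constant_neq0 nz_O sz_O.
case/Bezout_eq1_coprimepP => [[u1 u2]] /= bezout.
have [a [b ->]] := poly_even_odd K2 g.
exists (a + b * E * u2), (b ^+ 2 * (u2 ^+ 2 + 'X * u1 ^+ 2 * r)).
have XE : 'X = E ^+ 2 * u2 ^+ 2 + r * u2 ^+ 2 + 'X * u1 ^+ 2 * r ^+ 2.
  have -> : E ^+ 2 * u2 ^+ 2 + r * u2 ^+ 2 + 'X * u1 ^+ 2 * r ^+ 2
     = 'X * (u1 * r + u2 * O) ^+ 2 by rewrite {1}def_r; ring_char2 P2.
  by rewrite bezout expr1n mulr1.
rewrite {1}XE; ring_char2 P2.
Qed.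

(** Up to fractions [f^2 + f], [p^3/r^2 = (h/r)^2 + k/r] equals [(h + k)/r], with denominator only
    [r]. Adding 1 gives [s/r], of the form [v^2 + v] at every point, so [s] is a multiple of [r]. *)
Lemma pencil_discriminant :
  exists2 h : {poly K}, (size h <= 4)%N & p ^+ 3 = h ^+ 2 + h * r + r ^+ 2.
Proof.
have [h0 [k0 def_p3]] := sqrt_modp (p ^+ 3).
pose h : {poly K} := h0 %% r; pose k : {poly K} := k0 + r * (h0 %/ r) ^+ 2.
have nz_r : r != 0 by rewrite -size_poly_gt0 sz_r.
have {}def_p3 : p ^+ 3 = h ^+ 2 + r * k.
  by rewrite def_p3 {1}(divp_eq h0 r) -/h /k; move: (h0 %/ r) => d; ring_char2 P2.
have sz_h : (size h <= 3)%N by rewrite -ltnS -[4%N]sz_r ltn_modp.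
have sz_k : (size k <= 4)%N.
  have [->|nz_k] := eqVneq k 0; first by rewrite size_poly0.
  have szM : size (r * k) = (size r + size k).-1 by exact: size_mul.
  have : (size (p ^+ 3 + h ^+ 2)%R <= 7)%N.
    apply: leq_trans (size_polyD _ _) _; rewrite geq_max.
    have sp3 : (size (p ^+ 3) <= ((size p).-1 * 3).+1)%N by exact: size_poly_exp_leq.
    have sh2 : (size (h ^+ 2) <= ((size h).-1 * 2).+1)%N by exact: size_poly_exp_leq.
    by apply/andP; split; lia.
  have -> : p ^+ 3 + h ^+ 2 = r * k by rewrite def_p3; ring_char2 P2.
  by rewrite szM sz_r; move: (size k) => e; lia.
pose s : {poly K} := h + k + r.
have s_tr x : exists v, s.[x] = (v ^+ 2 + v) * r.[x].
  have [u eq_u] := rootless_cubic_artin_schreier cardK (no_root x).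
  have nz_rx := pencil_constant_neq0 x; exists (u + h.[x] / r.[x]).
  have p3x : p.[x] ^+ 3 = h.[x] ^+ 2 + r.[x] * k.[x].
    by have := congr1 (horner^~ x) def_p3; rewrite /= hornerD !horner_exp hornerM.
  apply: (mulIf nz_rx); transitivity ((u ^+ 2 + u) * r.[x] ^+ 2 + h.[x] ^+ 2 + h.[x] * r.[x]).
    by rewrite eq_u p3x !hornerD; ring_char2 F2.
  have -> : (u + h.[x] / r.[x]) ^+ 2 = u ^+ 2 + (h.[x] / r.[x]) ^+ 2 by ring_char2 F2.
  by field.
have sz_s : (size s <= 4)%N.
  apply: leq_trans (size_polyD _ _) _; rewrite geq_max sz_r leqnn andbT.
  by apply: leq_trans (size_polyD _ _) _; rewrite geq_max sz_k andbT ltnW.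
have [c def_s] := trace_form_multiple K2 cardK n_gt1 sz_r pencil_constant_neq0 sz_s s_tr.
have [v] := s_tr 0; rewrite def_s hornerZ => /(mulIf (pencil_constant_neq0 0)) def_c.
(* Replacing [h] by [h + v r] changes [h^2 + h r] by [(v^2 + v) r^2], which absorbs the constant
   [c]. *)
exists (h + v *: r).
  apply: leq_trans (size_polyD _ _) _; rewrite geq_max (leq_trans sz_h) //=.
  by apply: leq_trans (size_scale_leq _ _) _; rewrite sz_r.
have def_k : k = h + r + c *: r by rewrite -def_s /s; ring_char2 P2.
rewrite def_p3 def_k def_c -!mul_polyC rmorphD rmorphXn; ring_char2 P2.
Qed.

End CubicPencil.

(** * Linear roots of a pencil of rootless cubics *)

Lemma closed_cbrt (L : closedFieldType) (c : L) : exists d, c = d ^+ 3.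
Proof.
have [d eq_d] := closed_cubic_root 0 (- c); exists d.
by move/eqP: eq_d; rewrite mul0r addr0 subr_eq0 => /eqP.
Qed.

(** By coprimality [P] is associate to [gcdp a P * gcdp b P]. The cubes of these gcds divide [a] and
    [b] with constant quotients, and constants are cubes in [L]. *)
Lemma coprime_cubes (L : closedFieldType) (a b P : {poly L}) :
  P != 0 -> coprimep a b -> a * b = P ^+ 3 ->
  exists l1 l2 : {poly L}, [/\ a = l1 ^+ 3, b = l2 ^+ 3 & P = l1 * l2].
Proof.
move=> nz_P cop_ab def_ab.
have nz_ab : a * b != 0 by rewrite def_ab expf_neq0.
have cube_dvd (x y : {poly L}) : coprimep x y -> x * y = P ^+ 3 -> gcdp x P ^+ 3 %| x.
  move=> cop_xy def_xy; rewrite -(@Gauss_dvdpl _ x y).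
    by rewrite def_xy dvdp_exp2r // dvdp_gcdr.
  by rewrite coprimep_expl // (coprimep_dvdr (dvdp_gcdl x P)).
pose g1 := gcdp a P; pose g2 := gcdp b P.
have /dvdpP[c1 def_a] : g1 ^+ 3 %| a by apply: cube_dvd cop_ab def_ab.
have /dvdpP[c2 def_b] : g2 ^+ 3 %| b.
  by apply: (cube_dvd b a); [rewrite coprimep_sym | rewrite mulrC].
have P_dvd : P %| g1 * g2.
  rewrite (eqp_dvdr _ (mulp_gcdl _ _ _)) dvdp_gcd.
  rewrite (eqp_dvdr _ (mulp_gcdr _ _ _)) (eqp_dvdr P (mulp_gcdr _ _ _)) !dvdp_gcd.
  by rewrite def_ab dvdp_exp // dvdp_mull // !dvdp_mulr.
have dvd_P : g1 * g2 %| P.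
  rewrite Gauss_dvdp ?dvdp_gcdr // (coprimep_dvdr (dvdp_gcdl a P)) //.
  exact: coprimep_dvdl (dvdp_gcdl b P) cop_ab.
have /eqpf_eq[eps nz_eps def_P] : P %= g1 * g2 by rewrite /eqp P_dvd dvd_P.
have nz_g : g1 * g2 != 0 by apply: contra_neq nz_P => g0; rewrite def_P g0 scaler0.
have c12 : c1 * c2 = (eps ^+ 3)%:P.
  apply: (mulIf (expf_neq0 3 nz_g)); transitivity (a * b).
    by rewrite def_a def_b; ring.
  by rewrite def_ab def_P -mul_polyC rmorphXn; ring.
have : size (c1 * c2) == 1%N by rewrite c12 size_polyC expf_neq0.
rewrite size_mul_eq1 => /andP[/size_poly1P[d1 nz_d1 def_c1] /size_poly1P[d2 nz_d2 def_c2]].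
have [m1 def_d1] := closed_cbrt d1; have [m2 def_d2] := closed_cbrt d2.
have eps3 : eps ^+ 3 = (m1 * m2) ^+ 3.
  by apply: polyC_inj; rewrite -c12 def_c1 def_c2 def_d1 def_d2 -polyCM exprMn.
have nz_m : m1 * m2 != 0.
  by apply: contra_neq (expf_neq0 3 nz_eps) => m0; rewrite eps3 m0 expr0n.
(* The chosen cube roots give [P] only up to a cube root of unity, which [zeta] corrects. *)
pose zeta := eps / (m1 * m2).
have zeta3 : zeta ^+ 3 = 1 by rewrite expr_div_n eps3 divff // expf_neq0.
exists (m1%:P * g1), ((zeta * m2)%:P * g2); split.
- by rewrite def_a def_c1 def_d1 rmorphXn exprMn.
- by rewrite def_b def_c2 def_d2 exprMn -rmorphXn [(zeta * m2) ^+ 3]exprMn zeta3 mul1r.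
- have -> : m1%:P * g1 * ((zeta * m2)%:P * g2) = (zeta * (m1 * m2))%:P * (g1 * g2).
    by rewrite !polyCM; ring.
  by rewrite divfK // mul_polyC.
Qed.

Section SplitPencil.
Variables (K : finFieldType) (L : closedFieldType) (j : {rmorphism K -> L}) (n : nat).
Variables p r : {poly K}.
Hypothesis cardK : #|K| = (2 ^ n.+2)%N.
Hypothesis n_gt1 : (1 < n)%N.
Hypothesis nz_p : p != 0.
Hypothesis sz_p : (size p <= 3)%N.
Hypothesis sz_r : size r = 4.
Hypothesis no_root : forall x k, k ^+ 3 + p.[x] * k + r.[x] != 0.

Let L2 : 2%N \in [pchar L] := image_pchar2 j cardK.
Let PL2 : (2 : {poly L}) = 0.
Proof. by apply: pchar2_eq0; rewrite pchar_poly. Qed.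

(* [p^3 = h^2 + h r + r^2 = (h + omega r) (h + omega^2 r)] with coprime factors,
   so that [p = l1 l2] and [r = l1^3 + l2^3], and [l1 + l2] is a root by the
   factorization of [x^3 + y^3 + z^3 - 3xyz]. *)
Lemma pencil_linear_root : exists2 z : {poly L}, (size z <= 2)%N &
  z ^+ 3 + map_poly j p * z + map_poly j r = 0.
Proof.
have [h sz_h def_p3] := pencil_discriminant cardK n_gt1 sz_p sz_r no_root.
have [w eq_w] : exists w : L, w ^+ 2 + w + 1 = 0.
  have [w] := @GRing.solve_monicpoly L 2 (nth 0 [:: - 1; - 1]) isT.
  by rewrite !big_ord_recl big_ord0 /= => eq_w; exists w; rewrite eq_w; ring.
set P := map_poly j p; set R := map_poly j r; pose H := map_poly j h.
have def_P3 : P ^+ 3 = H ^+ 2 + H * R + R ^+ 2.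
  by rewrite -rmorphXn def_p3 !rmorphD rmorphM !rmorphXn.
have eq_W : w%:P ^+ 2 + w%:P + 1 = 0 :> {poly L}.
  by rewrite -rmorphXn -rmorphD -(rmorph1 polyC) -rmorphD /= eq_w.
have nz_P : P != 0 by rewrite map_poly_eq0.
pose a := H + w%:P * R; pose b := H + (w%:P + 1) * R.
have def_ab : a * b = P ^+ 3.
  rewrite def_P3 -[RHS]addr0 -(mul0r (R ^+ 2)) -eq_W /a /b; ring_char2 PL2.
have copPR : coprimep R P.
  rewrite coprimep_map; apply: cubic_coprime => //.
  exact: pencil_constant_neq0 no_root.
(* As [b = a + R], a common factor divides [R], which is coprime to [a * b = P^3]. *)
have cop_ab : coprimep a b.
  have -> : b = 1 * a + R by rewrite /a /b; ring_char2 PL2.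
  rewrite coprimep_addl_mul coprimep_sym.
  have : coprimep R (a * b) by rewrite def_ab coprimep_expr.
  by rewrite coprimepMr => /andP[].
have [l1 [l2 [def_a def_b def_P]]] := coprime_cubes nz_P cop_ab def_ab.
have sz_cube (l : {poly L}) : (size (l ^+ 3) <= 4)%N -> (size l <= 2)%N.
  have e : (size (l ^+ 3)).-1 = ((size l).-1 * 3)%N := size_exp l 3; lia.
have sz_comb (c : {poly L}) : (size c <= 1)%N -> (size (H + c * R)%R <= 4)%N.
  move=> sz_c; apply: leq_trans (size_polyD _ _) _; rewrite geq_max size_map_poly sz_h.
  apply: leq_trans (size_polyMleq _ _) _; rewrite size_map_poly sz_r.
  by move: sz_c; move: (size c) => e; lia.
have sz_1 : (size l1 <= 2)%N.
  by apply: sz_cube; rewrite -def_a sz_comb // size_polyC_leq1.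
have sz_2 : (size l2 <= 2)%N.
  apply: sz_cube; rewrite -def_b sz_comb //.
  by rewrite -(rmorph1 polyC) -rmorphD size_polyC_leq1.
exists (l1 + l2); first by apply: leq_trans (size_polyD _ _) _; rewrite geq_max sz_1.
have -> : R = a + b by rewrite /a /b; ring_char2 PL2.
rewrite def_P def_a def_b; ring_char2 PL2.
Qed.

End SplitPencil.

(** Three applications of the Frobenius of [K] fix [z], and together they are the [#|F|]-th power
    map. *)
Lemma rootless_cubic_root_in (K F : finFieldType) (L : fieldType)
    (i : {rmorphism K -> F}) (j : {rmorphism F -> L}) m (p r : K) (z : L) :
  #|K| = (2 ^ m)%N -> #|F| = (#|K| ^ 3)%N ->
  (forall k, k ^+ 3 + p * k + r != 0) ->
  z ^+ 3 + j (i p) * z + j (i r) = 0 -> exists y, z = j y.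
Proof.
move=> cardK cardF no_root rt_z; apply: fixed_in_image.
have [_ z3 _ _] := @rootless_cubic_roots K L (j \o i) m cardK p r no_root z rt_z.
by rewrite cardF !expnS expn0 muln1 !exprM.
Qed.

(** Setting [y = 1] gives a pencil with a root linear in [x] over the closure. Its coefficients are
    roots of the members at [(1, 0)] and [(0, 1)], which are rootless over [K], so both lie in
    [F]. *)
Lemma ternary_cubic_linear_root (K F : finFieldType) (i : {rmorphism K -> F}) n
    (p2 p1 p0 r3 r2 r1 r0 : K) :
  #|K| = (2 ^ n.+2)%N -> (1 < n)%N -> #|F| = (#|K| ^ 3)%N -> p1 != 0 ->
  (forall x y t, (x, y) != (0, 0) ->
    t ^+ 3 + (p2 * x ^+ 2 + p1 * x * y + p0 * y ^+ 2) * t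
    + (r3 * x ^+ 3 + r2 * x ^+ 2 * y + r1 * x * y ^+ 2 + r0 * y ^+ 3) != 0) ->
  exists al be : F, forall x y t, t = al * x + be * y ->
    t ^+ 3 + (i p2 * x ^+ 2 + i p1 * x * y + i p0 * y ^+ 2) * t
    + (i r3 * x ^+ 3 + i r2 * x ^+ 2 * y + i r1 * x * y ^+ 2 + i r0 * y ^+ 3) = 0.
Proof.
move=> cardK n_gt1 cardF nz_p1 no_zero.
pose p := p2%:P * 'X^2 + p1%:P * 'X + p0%:P.
pose r := r3%:P * 'X^3 + r2%:P * 'X^2 + r1%:P * 'X + r0%:P.
have no_root_inf k : k ^+ 3 + p2 * k + r3 != 0.
  have := no_zero 1 0 k; rewrite xpair_eqE oner_eq0 => /(_ isT).
  by rewrite !expr1n !expr0n !mulr0 !mulr1 !addr0.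
have no_root_0 k : k ^+ 3 + p0 * k + r0 != 0.
  have := no_zero 0 1 k; rewrite xpair_eqE oner_eq0 andbF => /(_ isT).
  by rewrite !expr1n !expr0n !mulr0 !mul0r !mulr1 !add0r.
have no_root x k : k ^+ 3 + p.[x] * k + r.[x] != 0.
  have := no_zero x 1 k; rewrite xpair_eqE oner_eq0 andbF => /(_ isT).
  by rewrite !expr1n !mulr1 /p /r !hornerE /=.
have nz_r3 : r3 != 0 by have := no_root_inf 0; rewrite expr0n mulr0 !add0r.
have sz_p : (size p <= 3)%N.
  by rewrite /p !size_polyD_leq // ?mul_polyC ?(leq_trans (size_scale_leq _ _))
    ?size_polyXn ?size_polyX ?(leq_trans (size_polyC_leq1 _)).
have sz_r : size r = 4.
  have szX : size (r3%:P * 'X^3) = 4 by rewrite mul_polyC size_scale // size_polyXn.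
  rewrite /r -!addrA size_polyDl szX // ltnS.
  by rewrite !size_polyD_leq // ?mul_polyC ?(leq_trans (size_scale_leq _ _))
    ?size_polyXn ?size_polyX ?(leq_trans (size_polyC_leq1 _)).
have nz_p : p != 0.
  apply: contra_neq nz_p1 => /(congr1 (fun g : {poly K} => g`_1)).
  by rewrite /p !coefE /= mulr0 mulr1 add0r addr0.
have [L [j _]] := countable_algebraic_closure F.
have [z sz_z] := @pencil_linear_root K L (j \o i) n p r cardK n_gt1 nz_p sz_p sz_r no_root.
have PL2 : (2 : {poly L}) = 0.
  by apply: pchar2_eq0; rewrite pchar_poly; apply: (@image_pchar2 K L (j \o i) _ cardK).
have [a [b ->]] : exists a b : L, z = a%:P * 'X + b%:P.
  exists z`_1, z`_0; apply/polyP=> k; rewrite !coefE.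
  case: k => [|[|k]] /=; rewrite ?mulr0 ?mulr1 ?add0r ?addr0 //.
  by rewrite nth_default // (leq_trans sz_z).
rewrite /p /r !rmorphD !rmorphM /= !map_polyX !map_polyC /= => eq_z.
have {sz_z z}eq_ab : (a ^+ 3 + j (i p2) * a + j (i r3))%:P * 'X^3
   + (a ^+ 2 * b + j (i p2) * b + j (i p1) * a + j (i r2))%:P * 'X^2
   + (a * b ^+ 2 + j (i p1) * b + j (i p0) * a + j (i r1))%:P * 'X
   + (b ^+ 3 + j (i p0) * b + j (i r0))%:P = 0.
  rewrite -[RHS]eq_z !rmorphD !rmorphM /=; ring_char2 PL2.
have coef_ab k := congr1 (fun g : {poly L} => g`_k) eq_ab.
have := coef_ab 3; rewrite !coefE /= !(mulr0, mulr1, addr0) => c3.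
have := coef_ab 2; rewrite !coefE /= !(mulr0, mulr1, addr0, add0r) => c2.
have := coef_ab 1; rewrite !coefE /= !(mulr0, mulr1, addr0, add0r) => c1.
have := coef_ab 0; rewrite !coefE /= !(mulr0, mulr1, addr0, add0r) => c0.
have [al def_a] := rootless_cubic_root_in cardK cardF no_root_inf c3.
have [be def_b] := rootless_cubic_root_in cardK cardF no_root_0 c0.
have F2 : (2 : F) = 0 := pchar2_eq0 (image_pchar2 i cardK).
exists al, be; move=> x y t ->.
rewrite {}def_a {}def_b in c0 c1 c2 c3.
have {}c3 : al ^+ 3 + i p2 * al + i r3 = 0.
  by apply: (fmorph_inj j); rewrite !rmorphD ?rmorphM ?rmorphXn ?rmorphM ?rmorphXn rmorph0.
have {}c2 : al ^+ 2 * be + i p2 * be + i p1 * al + i r2 = 0.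
  by apply: (fmorph_inj j); rewrite !rmorphD ?rmorphM ?rmorphXn ?rmorphM ?rmorphXn rmorph0.
have {}c1 : al * be ^+ 2 + i p1 * be + i p0 * al + i r1 = 0.
  by apply: (fmorph_inj j); rewrite !rmorphD ?rmorphM ?rmorphXn ?rmorphM ?rmorphXn rmorph0.
have {}c0 : be ^+ 3 + i p0 * be + i r0 = 0.
  by apply: (fmorph_inj j); rewrite !rmorphD ?rmorphM ?rmorphXn ?rmorphM ?rmorphXn rmorph0.
transitivity ((al ^+ 3 + i p2 * al + i r3) * x ^+ 3
  + (al ^+ 2 * be + i p2 * be + i p1 * al + i r2) * x ^+ 2 * y
  + (al * be ^+ 2 + i p1 * be + i p0 * al + i r1) * x * y ^+ 2
  + (be ^+ 3 + i p0 * be + i r0) * y ^+ 3); first by ring_char2 F2.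
by rewrite c3 c2 c1 c0 !mul0r !addr0.
Qed.

(** * The fixed field of a power of Frobenius *)

Section Frobenius.
Variables (F : finFieldType) (m : nat).
Hypothesis F2 : 2%N \in [pchar F].

(* The proof argument is there for the canonical instances below, which need to
   recover it from the term. *)
Definition frob (_ : 2%N \in [pchar F]) (x : F) : F := x ^+ (2 ^ m).

Fact frob_is_zmod_morphism : zmod_morphism (frob F2).
Proof. by move=> x y; rewrite /frob (oppr_pchar2 F2) exprD_pow2 // (oppr_pchar2 F2). Qed.

Fact frob_is_monoid_morphism : monoid_morphism (frob F2).
Proof. by split=> [|x y]; rewrite /frob ?expr1n ?exprMn. Qed.

HB.instance Definition _ :=
  GRing.isZmodMorphism.Build F F (frob F2) frob_is_zmod_morphism.
HB.instance Definition _ :=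
  GRing.isMonoidMorphism.Build F F (frob F2) frob_is_monoid_morphism.

Definition frob_fixed (_ : 2%N \in [pchar F]) : pred F := fun x => frob F2 x == x.

Fact frob_fixed_divring_closed : divring_closed (frob_fixed F2).
Proof.
split=> [|x y|x y]; rewrite !unfold_in /frob_fixed ?rmorph1 // => /eqP fix_x /eqP fix_y.
  by rewrite rmorphB /= fix_x fix_y.
by rewrite fmorph_div /= fix_x fix_y.
Qed.

HB.instance Definition _ :=
  GRing.isDivringClosed.Build F (frob_fixed F2) frob_fixed_divring_closed.

Record fixed_field := FixedField { fixed_val :> F; _ : frob_fixed F2 fixed_val }.

HB.instance Definition _ := [isSub for fixed_val].
HB.instance Definition _ := [Finite of fixed_field by <:].
HB.instance Definition _ := [SubChoice_isSubIntegralDomain of fixed_field by <:].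
HB.instance Definition _ := [SubIntegralDomain_isSubField of fixed_field by <:].


(** With [g = X^q + X], the sum [g^(q^2) + g^q + g] telescopes to [X^(q^3) - X], a product of
    distinct linear factors over [F]; so its divisor [g] has [q] roots there. *)
Lemma card_fixed_field : (0 < m)%N -> #|F| = (2 ^ (3 * m))%N -> #|{: fixed_field}| = (2 ^ m)%N.
Proof.
move=> m_gt0 cardF.
have PF2 : 2%N \in [pchar {poly F}] by rewrite pchar_poly.
set q := (2 ^ m)%N; pose g : {poly F} := 'X^q + 'X.
have sz_g : size g = q.+1.
  rewrite size_polyDl ?size_polyXn // size_polyX ltnS.
  exact: (@leq_pexp2l 2 1 m).
have nz_g : g != 0 by rewrite -size_poly_gt0 sz_g.
have root_g x : root g x = frob_fixed F2 x.
  by rewrite rootE hornerD hornerXn hornerX (addr_eq0_pchar2 F2).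
have g_dvd : g %| \prod_(x <- enum F) ('X - x%:P).
  rewrite big_enum /= -finField_genPoly.
  have -> : 'X^#|F| - 'X = g ^+ (2 ^ (m + m)) + g ^+ q + g.
    rewrite cardF (oppr_pchar2 PF2) /g !exprD_pow2 // -!exprM -!expnD.
    have -> : (3 * m = m + (m + m))%N by lia.
    by rewrite /q; ring_char2 (pchar2_eq0 PF2).
  have g_exp k : g %| g ^+ (2 ^ k) by rewrite dvdp_exp ?expn_gt0.
  apply: dvdp_add; last exact: dvdpp.
  by apply: dvdp_add; apply: g_exp.
have [b eq_g] := dvdp_prod_XsubC g_dvd.
have card_b : size (mask b (enum F)) = q.
  by apply: succn_inj; rewrite -(size_prod_XsubC _ id) -(eqp_size eq_g) sz_g.
have uniq_b : uniq (mask b (enum F)) by rewrite mask_uniq ?enum_uniq.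
rewrite card_sub; apply/eqP; rewrite eqn_leq; apply/andP; split.
  rewrite cardE -ltnS -sz_g; apply: max_poly_roots; rewrite ?enum_uniq //.
  by apply/allP=> x; rewrite mem_enum root_g.
rewrite -card_b -(card_uniqP uniq_b); apply/subset_leq_card/subsetP=> x x_b.
by rewrite inE -root_g (eqp_root eq_g) root_prod_XsubC.
Qed.

End Frobenius.

Lemma subfield_frobenius (F : finFieldType) m : (0 < m)%N -> #|F| = (2 ^ (3 * m))%N ->
  exists (K : finFieldType) (i : {rmorphism K -> F}) (s : {rmorphism F -> F}),
  #|K| = (2 ^ m)%N /\ (forall x, s x = x ^+ (2 ^ m)).
Proof.
move=> m_gt0 cardF; have F2 : 2%N \in [pchar F] by apply: card_finPcharP cardF _.
by exists (fixed_field m F2), \val, (frob m F2); split; first exact: card_fixed_field.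
Qed.

(** * Trinomials and cubic forms in the conjugates *)

Lemma fin_poly_eq0 (F : finFieldType) (g : {poly F}) :
  (size g <= #|F|)%N -> (forall x, g.[x] = 0) -> g = 0.
Proof.
move=> sz_g g0; apply/eqP; apply: contraT => nz_g.
have : (size (enum F) < size g)%N.
  apply: max_poly_roots; rewrite ?enum_uniq //.
  by apply/allP=> x _; apply/rootP.
by rewrite -cardE ltnNge sz_g.
Qed.

Lemma additive_inj_surj (F : finFieldType) (f : F -> F) :
  (forall x y, f (x + y) = f x + f y) -> (forall x, f x = 0 -> x = 0) ->
  forall y, exists x, f x = y.
Proof.
move=> fD f0 y; have f00 : f 0 = 0 by apply: (addrI (f 0)); rewrite -fD !addr0.
have fN x : f (- x) = - f x.
  by apply: (addrI (f x)); rewrite -fD !subrr.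
have f_inj : injective f.
  move=> u v fuv; apply/eqP; rewrite -subr_eq0; apply/eqP/f0.
  by rewrite fD fN fuv subrr.
have [g _ gK] := injF_bij f_inj; by exists (g y).
Qed.

Ltac decide_exponents :=
  repeat match goal with
  | |- context [@eq_op _ ?a ?b] => have -> : (a == b)%N = false by nia
  end.

Section Trinomials.
Variables (F : finFieldType) (q : nat) (s : {rmorphism F -> F}).
Hypothesis F2 : 2%N \in [pchar F].
Hypothesis cardF : #|F| = (q ^ 3)%N.
Hypothesis q_gt3 : (3 < q)%N.
Hypothesis sE : forall x, s x = x ^+ q.

Let R2 : (2 : F) = 0 := pchar2_eq0 F2.

Lemma frob3 x : s (s (s x)) = x.
Proof. by rewrite !sE -!exprM -{2}(expf_card x) cardF !expnS expn0 muln1 mulnA. Qed.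

Lemma linear_trinomial_eq0 c0 c1 c2 :
  (forall x, c0 * x + c1 * s x + c2 * s (s x) = 0) -> [/\ c0 = 0, c1 = 0 & c2 = 0].
Proof.
move=> van; pose g := c0 *: 'X + c1 *: 'X^q + c2 *: 'X^(q * q).
have g0 : g = 0.
  apply: fin_poly_eq0 => [|x]; last first.
    by rewrite !hornerE -(van x) !sE exprM.
  by rewrite /g !size_polyD_leq // (leq_trans (size_scale_leq _ _)) // ?size_polyX
    ?size_polyXn cardF; nia.
have cf k := congr1 (fun g : {poly F} => g`_k) g0.
have := cf 1%N; have := cf q; have := cf (q * q)%N; rewrite /g !coefE !eqxx.
decide_exponents; by rewrite !mulr0 !mulr1 !addr0 !add0r.
Qed.

Definition tr (x : F) : F := x + s x + s (s x).

Lemma tr_nondegenerate y : (forall x, tr (y * x) = 0) -> y = 0.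
Proof.
move=> y_tr; have [] := @linear_trinomial_eq0 y (s y) (s (s y)) => // x.
by rewrite -!rmorphM -[RHS](y_tr x).
Qed.

Definition nm (x : F) : F := x * s x * s (s x).

Lemma tr_fixed x : s (tr x) = tr x.
Proof. by rewrite /tr !rmorphD frob3; ring. Qed.

Lemma nm_neq0 x : x != 0 -> nm x != 0.
Proof. by move=> nz_x; rewrite !mulf_neq0 ?fmorph_eq0. Qed.

(* The ten monomials of a cubic form in [w, s w, s (s w)] have distinct
   exponents below [q^3], so their coefficients are determined by its values. *)
Lemma cubic_form_eq0 e p0 p1 p2 r0 r1 r2 t0 t1 t2 :
  (forall w, let w1 := s w in let w2 := s w1 in
    e * (w * w1 * w2) + p0 * w ^+ 3 + p1 * w1 ^+ 3 + p2 * w2 ^+ 3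
    + r0 * (w * w1 ^+ 2) + r1 * (w1 * w2 ^+ 2) + r2 * (w2 * w ^+ 2)
    + t0 * (w * w2 ^+ 2) + t1 * (w1 * w ^+ 2) + t2 * (w2 * w1 ^+ 2) = 0) ->
  [/\ e = 0, p0 = 0, r0 = 0 & t0 = 0].
Proof.
move=> van.
pose g := e *: 'X^(1 + q + q * q) + p0 *: 'X^3 + p1 *: 'X^(3 * q)
  + p2 *: 'X^(3 * (q * q)) + r0 *: 'X^(1 + 2 * q) + r1 *: 'X^(q + 2 * (q * q))
  + r2 *: 'X^(q * q + 2) + t0 *: 'X^(1 + 2 * (q * q)) + t1 *: 'X^(q + 2)
  + t2 *: 'X^(q * q + 2 * q).
have g0 : g = 0.
  apply: fin_poly_eq0 => [|x].
    rewrite /g !size_polyD_leq // (leq_trans (size_scale_leq _ _)) // size_polyXn cardF; nia.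
  have xqq : s (s x) = x ^+ (q * q) by rewrite !sE exprM.
  rewrite !hornerE -(van x) /= xqq !sE -!mulnA !exprD.
  by move: (x ^+ q) (x ^+ (q * q)) => y z; ring.
have cf k := congr1 (fun g : {poly F} => g`_k) g0.
have := cf (1 + q + q * q)%N; have := cf 3%N; have := cf (1 + 2 * q)%N.
have := cf (1 + 2 * (q * q))%N; rewrite /g !coefE !eqxx.
decide_exponents; by rewrite !mulr0 !mulr1 !addr0 !add0r.
Qed.
End Trinomials.

(** * The cubic form of a planar function *)

Section Planarity.
Variables (F : finFieldType) (q : nat) (s : {rmorphism F -> F}).
Hypothesis F2 : 2%N \in [pchar F].
Hypothesis cardF : #|F| = (q ^ 3)%N.
Hypothesis q_gt3 : (3 < q)%N.
Hypothesis sE : forall x, s x = x ^+ q.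
Variables a b c : F.

Let R2 : (2 : F) = 0 := pchar2_eq0 F2.
Let s3 := frob3 cardF sE.
Let tri0 := linear_trinomial_eq0 cardF q_gt3 sE.

Definition star x y := x * y + a * (s x * y + x * s y)
  + b * (s (s x) * s y + s x * s (s y)) + c * (s (s x) * y + x * s (s y)).

(** In the coordinates [x], [s x], [s (s x)], the form [tr s (w * star x y)] has a symmetric matrix
    with diagonal [w], [s w], [s (s w)] and off-diagonal entries the conjugates of [polar w]. Its
    first row yields [adj w x], and [cubic w] is its determinant in characteristic 2. *)
Definition polar w := a * w + s c * s w + s (s b) * s (s w).

Definition adj w x := w * x + polar w * s x + s (s (polar w)) * s (s x).

Definition cubic w := w * s w * s (s w) + w * s (polar w) ^+ 2
  + s w * s (s (polar w)) ^+ 2 + s (s w) * polar w ^+ 2.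

Lemma tr_star w x y : tr s (w * star x y) = tr s (y * adj w x).
Proof. by rewrite /tr /star /adj /polar !(rmorphD, rmorphM, s3) /=; ring. Qed.

Lemma starDr x y z : star x (y + z) = star x y + star x z.
Proof. by rewrite /star !rmorphD; ring. Qed.

Lemma adjDl w w' x : adj (w + w') x = adj w x + adj w' x.
Proof. by rewrite /adj /polar !(rmorphD, rmorphM) /=; ring. Qed.

Lemma adjDr w x y : adj w (x + y) = adj w x + adj w y.
Proof. by rewrite /adj !rmorphD; ring. Qed.

(** If no product vanishes, [star x] is onto by finiteness, so [adj w x = 0] makes [w] orthogonal to
    [F] under the trace form. The converse exchanges the roles of [w] and [y]. *)
Lemma star_adj_neq0 :
  (forall x y, x != 0 -> y != 0 -> star x y != 0) <->
  (forall w x, w != 0 -> x != 0 -> adj w x != 0).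
Proof.
have trN := tr_nondegenerate cardF q_gt3 sE.
have tr0 : tr s 0 = 0 by rewrite /tr !rmorph0 !addr0.
split=> [star_nz w x nz_w nz_x | adj_nz x y nz_x nz_y].
  apply: contraNneq nz_w => adj0; apply/eqP/trN => z.
  have [y xy0|y <-] := additive_inj_surj (starDr x) _ z.
    by apply/eqP; apply: contra_eqT xy0 => nz_y; apply: star_nz.
  by rewrite tr_star adj0 mulr0.
apply: contraNneq nz_y => star0; apply/eqP/trN => z.
have [w wx0|w <-] := additive_inj_surj (fun w w' => adjDl w w' x) _ z.
  by apply/eqP; apply: contra_eqT wx0 => nz_w; apply: adj_nz.
by rewrite -tr_star star0 mulr0.
Qed.

(** Cramer's rule: the coefficients are the cofactors of the first row of the symmetric matrix of
    [w]. *)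
Lemma adj_cubic w x :
  let S01 := polar w in let S12 := s S01 in let S02 := s S12 in
  (s w * s (s w) + S12 ^+ 2) * adj w x + (S01 * s (s w) + S02 * S12) * s (adj w x)
  + (S01 * S12 + S02 * s w) * s (s (adj w x)) = cubic w * x.
Proof.
rewrite /cubic /adj; move: (polar w) => p.
by rewrite /= !(rmorphD, rmorphM, s3) /=; ring_char2 R2.
Qed.

Lemma cubic_adj_neq0 :
  (forall w x, w != 0 -> x != 0 -> adj w x != 0) <->
  (forall w, w != 0 -> cubic w != 0).
Proof.
split=> [adj_nz w nz_w | cubic_nz w x nz_w nz_x]; last first.
  apply: contraNneq (mulf_neq0 (cubic_nz w nz_w) nz_x) => adj0.
  by rewrite -adj_cubic adj0 !rmorph0 !mulr0 !addr0.
have adj_surj : forall y, exists x, adj w x = y.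
  apply: additive_inj_surj (adjDr w) _ => x wx0.
  by apply/eqP; apply: contra_eqT wx0 => nz_x; apply: adj_nz.
apply: contraNneq nz_w => cubic0; apply/eqP.
(* With zero determinant and [adj w] onto, the cofactors are the coefficients of a vanishing
   trinomial. *)
have [|c0 c1 c2] := @tri0 (s w * s (s w) + s (polar w) ^+ 2)
    (polar w * s (s w) + s (s (polar w)) * s (polar w))
    (polar w * s (polar w) + s (s (polar w)) * s w).
  by move=> y; have [x <-] := adj_surj y; rewrite adj_cubic cubic0 mul0r.
(* Eliminating [x] between the first two rows leaves conjugates of cofactors, so this trinomial
   vanishes as well, including its coefficient [w]. *)
have [|_ ->] := @tri0 (polar w) w 0 => // y; have [x <-] := adj_surj y.
transitivity (s (s (s w * s (s w) + s (polar w) ^+ 2)) * s x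
  + s (polar w * s (s w) + s (s (polar w)) * s (polar w)) * s (s x)).
  rewrite /adj; move: (polar w) => p.
  by rewrite !(rmorphD, rmorphM, s3) /=; ring_char2 R2.
by rewrite c0 c1 !rmorph0 !mul0r addr0.
Qed.

Lemma planar_star : planar (P2 q a b c) <->
  (forall x y, x != 0 -> y != 0 -> star x y != 0).
Proof.
have P2D x y : P2 q a b c (x + y) + P2 q a b c x + y * x = star x y + P2 q a b c y.
  have PE z : P2 q a b c z = a * s z * z + b * s (s z) * s z + c * s (s z) * z.
    by rewrite /P2 !exprD !expr1 expnS expn1 exprM -!sE; ring.
  by rewrite !PE /star !rmorphD; ring_char2 R2.
split=> [pl x y nz_x nz_y | star_nz y nz_y].
  have [g gK _] := pl y nz_y; apply: contraNneq nz_x => xy0.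
  rewrite -(gK x) -[X in _ == X](gK 0) !P2D xy0.
  by rewrite /star !rmorph0 !(mul0r, mulr0, addr0).
apply: injF_bij => x x'; rewrite !P2D => /addIr; move/eqP; rewrite -subr_eq0 => star0.
apply/eqP; rewrite -subr_eq0; apply: contraTT star0 => nz_x.
suff -> : star x y - star x' y = star (x - x') y by rewrite star_nz.
by rewrite /star !rmorphB; ring.
Qed.

Lemma planar_cubic : planar (P2 q a b c) <-> (forall w, w != 0 -> cubic w != 0).
Proof. by rewrite planar_star star_adj_neq0 cubic_adj_neq0. Qed.

End Planarity.

(** * Forms that are products of conjugate lines *)

Section Parametrization.
Variables (F : finFieldType) (q : nat) (s : {rmorphism F -> F}).
Hypothesis F2 : 2%N \in [pchar F].
Hypothesis cardF : #|F| = (q ^ 3)%N.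
Hypothesis q_gt3 : (3 < q)%N.
Hypothesis sE : forall x, s x = x ^+ q.

Let R2 : (2 : F) = 0 := pchar2_eq0 F2.
Let s3 := frob3 cardF sE.

Lemma frob_square_field (x : F) : x ^+ (q ^ 2) = s (s x).
Proof. by rewrite !sE expnS expn1 exprM. Qed.

Lemma DeltaE u v : Delta q u v = u * s v + s u * s (s v) + s (s u) * v
  + u * s u * s (s u) + v * s v * s (s v).
Proof. by rewrite /Delta !exprD !expr1 !frob_square_field -!sE. Qed.

Lemma Delta_fixed u v : s (Delta q u v) = Delta q u v.
Proof. by rewrite !DeltaE !(rmorphD, rmorphM, s3) /=; ring. Qed.

Definition numa u v := s v + s u * s (s u) + s (s u) * (v * s v).
Definition numb u v := s (s u) * s v.
Definition numc u v := s v * s (s v) + s (s u) + u * s (s u) * s v.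

Definition line U V w := w + U * s w + V * s (s w).

(** Cramer's rule for the line and its two conjugates, a system of determinant
    [(Delta q u v + 1)^2]. *)
Lemma line_eq0 u v w : Delta q u v != 1 -> line (u ^+ 2) (v ^+ 2) w = 0 -> w = 0.
Proof.
rewrite -subr_eq0 (oppr_pchar2 F2) => nz_D line0.
have: (Delta q u v + 1) ^+ 2 * w == 0.
  have -> : (Delta q u v + 1) ^+ 2 * w =
     (1 + s u ^+ 2 * s (s v) ^+ 2) * line (u ^+ 2) (v ^+ 2) w
     + (u ^+ 2 + v ^+ 2 * s (s v) ^+ 2) * s (line (u ^+ 2) (v ^+ 2) w)
     + (u ^+ 2 * s u ^+ 2 + v ^+ 2) * s (s (line (u ^+ 2) (v ^+ 2) w)).
    rewrite DeltaE /line !(rmorphD, rmorphM, rmorphXn, s3) /=; ring_char2 R2.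
  by rewrite line0 !rmorph0 !mulr0 !addr0.
by rewrite mulf_eq0 expf_eq0 (negPf nz_D) => /eqP.
Qed.

(** As [s] fixes [d], the factor [d^2] clears all denominators. The parameters enter the line
    squared because [cubic] contains the polar terms squared. *)
Lemma cubic_line u v w : Delta q u v != 1 ->
  let d := 1 + Delta q u v in
  cubic s (numa u v / d) (numb u v / d) (numc u v / d) w * d ^+ 2
  = nm s (line (u ^+ 2) (v ^+ 2) w).
Proof.
rewrite -subr_eq0 (oppr_pchar2 F2) addrC => nz_d d.
have sd : s d = d by rewrite rmorphD rmorph1 Delta_fixed.
pose Q := numa u v * w + s (numc u v) * s w + s (s (numb u v)) * s (s w).
have polarE : polar s (numa u v / d) (numb u v / d) (numc u v / d) w = Q / d.
  by rewrite /polar !fmorph_div !sd /Q; ring.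
transitivity (w * s w * s (s w) * d ^+ 2 + w * s Q ^+ 2 + s w * s (s Q) ^+ 2
              + s (s w) * Q ^+ 2).
  rewrite /cubic polarE !fmorph_div !sd; field; exact: nz_d.
rewrite /d DeltaE /Q /nm /line /numa /numb /numc.
rewrite !(rmorphD, rmorphM, rmorphXn, s3) /=; ring_char2 R2.
Qed.

(** Coefficients are compared: [w * s w * s (s w)] gives [k d^2 = 1], so [d] is nonzero. The others
    give the squares of [a], [b], [c] up to conjugation, and square roots are unique. *)
Lemma cubic_line_coefs a b c k U V :
  (forall w, cubic s a b c w = k * nm s (line U V w)) ->
  exists u v, Delta q u v != 1 /\
    (a, b, c) = (numa u v / (1 + Delta q u v), numb u v / (1 + Delta q u v),
                 numc u v / (1 + Delta q u v)).
Proof.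
move=> cub; have [u def_U] := sqrt_pchar2 U F2; have [v def_V] := sqrt_pchar2 V F2.
pose d := 1 + Delta q u v.
have [e0 p0 r0 t0] :
  [/\ 1 + k * d ^+ 2 = 0, b ^+ 2 + k * numb u v ^+ 2 = 0,
      s a ^+ 2 + k * s (numa u v) ^+ 2 = 0 &
      s (s c) ^+ 2 + k * s (s (numc u v)) ^+ 2 = 0].
  pose p := b ^+ 2 + k * numb u v ^+ 2.
  pose r := s a ^+ 2 + k * s (numa u v) ^+ 2.
  pose t := s (s c) ^+ 2 + k * s (s (numc u v)) ^+ 2.
  apply: (@cubic_form_eq0 F q s cardF q_gt3 sE _ _
    (s b ^+ 2 + k * s (numb u v) ^+ 2) (s (s b) ^+ 2 + k * s (s (numb u v)) ^+ 2)
    _ (s (s a) ^+ 2 + k * s (s (numa u v)) ^+ 2) (a ^+ 2 + k * numa u v ^+ 2)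
    _ (c ^+ 2 + k * numc u v ^+ 2) (s c ^+ 2 + k * s (numc u v) ^+ 2)) => w w1 w2.
  transitivity (cubic s a b c w + k * nm s (line U V w)); last first.
    by rewrite cub (addrr_pchar2 F2).
  rewrite def_U def_V /d DeltaE /nm /cubic /polar /line /numa /numb /numc /w2 /w1.
  rewrite !(rmorphD, rmorphM, rmorphXn, s3) /=; ring_char2 R2.
have kd : k * d ^+ 2 = 1 by apply/esym/eqP; rewrite -(addr_eq0_pchar2 F2) e0.
have nz_d : d != 0 by apply: contra_eq_neq kd => ->; rewrite expr0n mulr0 eq_sym oner_eq0.
have k_inv : k = d^-1 ^+ 2.
  by apply: (mulIf (expf_neq0 2 nz_d)); rewrite kd exprVn mulVf ?expf_neq0.
have sd : s d = d by rewrite rmorphD rmorph1 Delta_fixed.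
have sq_eq x y : x ^+ 2 + k * y ^+ 2 = 0 -> x = y / d.
  move/eqP; rewrite (addr_eq0_pchar2 F2) k_inv -exprMn => /eqP eq_sq.
  by apply: (@expr_pow2_inj F 1 F2); rewrite /= eq_sq mulrC.
exists u, v; split.
  by apply: contraNneq nz_d => D1; rewrite /d D1 (addrr_pchar2 F2).
have -> : b = numb u v / d by apply: sq_eq.
have -> : a = numa u v / d.
  by apply: (fmorph_inj s); rewrite (sq_eq _ _ r0) fmorph_div sd.
have -> // : c = numc u v / d.
by do 2 apply: (fmorph_inj s); rewrite (sq_eq _ _ t0) !fmorph_div !sd.
Qed.

End Parametrization.

(** * Splitting the cubic form *)

Section Factorization.
Variables (K F : finFieldType) (i : {rmorphism K -> F}) (n : nat).
Variable s : {rmorphism F -> F}.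
Hypothesis cardK : #|K| = (2 ^ n.+2)%N.
Hypothesis n_gt1 : (1 < n)%N.
Hypothesis cardF : #|F| = (#|K| ^ 3)%N.
Hypothesis sE : forall x, s x = x ^+ #|K|.
Variables a b c : F.

Let F2 : 2%N \in [pchar F] := image_pchar2 i cardK.
Let R2 : (2 : F) = 0 := pchar2_eq0 F2.
Let s3 := frob3 cardF sE.
Let T := tr s.
Let cub := cubic s a b c.
Let lead := cub 1.
(** For fixed [z], [cub2 t] and [cub1 t] are the coefficients of [z^2] and [z] in [cub (z + t)]. The
    polar form [wedge] of [cub1] is also the determinant of the conjugates of [1], [t], [u]; [mixed]
    collects the cross terms of [cub]. *)
Let cub2 t := T (t * (1 + b ^+ 2 + s a ^+ 2 + s (s c) ^+ 2)).
Let cub1 t := T (t * s t) + T ((a ^+ 2 + b ^+ 2 + c ^+ 2) * t ^+ 2).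
Let wedge t u := T (t * s u + u * s t).
Let mixed t u := T (t * s t * s (s u)) + T (b ^+ 2 * t ^+ 2 * u
  + s a ^+ 2 * u * s t ^+ 2 + s (s c) ^+ 2 * u * s (s t) ^+ 2).

Lemma image_fixed k : s (i k) = i k.
Proof. by rewrite sE image_expr_card. Qed.

Lemma fixed_image x : s x = x -> exists k, x = i k.
Proof. by rewrite sE => /fixed_in_image. Qed.

Lemma cubic_fixed w : s (cub w) = cub w.
Proof. by rewrite /cub /cubic /polar !(rmorphD, rmorphM, s3) /=; ring. Qed.

Lemma cubic_shift z t : s z = z ->
  cub (z + t) = lead * z ^+ 3 + cub2 t * z ^+ 2 + cub1 t * z + cub t.
Proof.
move=> sz; rewrite /lead /cub /cubic /polar /cub1 /cub2 /T /tr.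
by rewrite !(rmorphD, rmorphM, rmorphXn, rmorph1, s3, sz) /=; ring_char2 R2.
Qed.

Lemma cub2_shift z t : s z = z -> cub2 (t + z) = cub2 t + z * lead.
Proof.
move=> sz; rewrite /lead /cub /cubic /polar /cub2 /T /tr.
by rewrite !(rmorphD, rmorphM, rmorphXn, rmorph1, s3, sz) /=; ring_char2 R2.
Qed.

Lemma cub2_comb x y t u : s x = x -> s y = y ->
  cub2 (x * t + y * u) = x * cub2 t + y * cub2 u.
Proof.
by move=> sx sy; rewrite /cub2 /T /tr !(rmorphD, rmorphM, s3, sx, sy) /=; ring.
Qed.

Lemma cub1_comb x y t u : s x = x -> s y = y ->
  cub1 (x * t + y * u) = cub1 t * x ^+ 2 + wedge t u * x * y + cub1 u * y ^+ 2.
Proof.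
move=> sx sy; rewrite /cub1 /wedge /T /tr.
by rewrite !(rmorphD, rmorphM, rmorphXn, s3, sx, sy) /=; ring_char2 R2.
Qed.

Lemma cub_comb x y t u : s x = x -> s y = y ->
  cub (x * t + y * u) = cub t * x ^+ 3 + mixed t u * x ^+ 2 * y
    + mixed u t * x * y ^+ 2 + cub u * y ^+ 3.
Proof.
move=> sx sy; rewrite /cub /cubic /polar /mixed /T /tr.
by rewrite !(rmorphD, rmorphM, rmorphXn, s3, sx, sy) /=; ring_char2 R2.
Qed.

Lemma wedge_shift x y t u : s x = x -> s y = y -> wedge (t + x) (u + y) = wedge t u.
Proof.
move=> sx sy; rewrite /wedge /T /tr.
by rewrite !(rmorphD, rmorphM, s3, sx, sy) /=; ring_char2 R2.
Qed.

(** A Vandermonde determinant in the conjugates of [t]. *)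
Lemma wedge_square t :
  wedge t (t ^+ 2) = (t + s t) * (s t + s (s t)) * (t + s (s t)).
Proof. by rewrite /wedge /T /tr !(rmorphD, rmorphM, rmorphXn, s3) /=; ring_char2 R2. Qed.

Lemma wedge_neq0_independent t u x y z : s x = x -> s y = y -> s z = z ->
  wedge t u != 0 -> z + (x * t + y * u) = 0 -> [/\ x = 0, y = 0 & z = 0].
Proof.
move=> sx sy sz nz_tu zero.
have x0 : x = 0.
  apply: (mulIf nz_tu); rewrite mul0r.
  transitivity ((s u + s (s u)) * (z + (x * t + y * u))
    + (u + s (s u)) * s (z + (x * t + y * u)) + (u + s u) * s (s (z + (x * t + y * u)))).
    by rewrite /wedge /T /tr !(rmorphD, rmorphM, s3, sx, sy, sz) /=; ring_char2 R2.
  by rewrite zero !rmorph0 !mulr0 !addr0.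
have y0 : y = 0.
  apply: (mulIf nz_tu); rewrite mul0r.
  transitivity ((s t + s (s t)) * (z + (x * t + y * u))
    + (t + s (s t)) * s (z + (x * t + y * u)) + (t + s t) * s (s (z + (x * t + y * u)))).
    by rewrite /wedge /T /tr !(rmorphD, rmorphM, s3, sx, sy, sz) /=; ring_char2 R2.
  by rewrite zero !rmorph0 !mulr0 !addr0.
by split=> //; rewrite -zero x0 y0 !mul0r !addr0.
Qed.

(** Cramer's rule for a line with prescribed values at [1], [t], [u]. *)
Lemma line_interpolation t u al be : wedge t u != 0 -> exists ca cb cc,
  [/\ ca + cb + cc = 1, ca * t + cb * s t + cc * s (s t) = al
    & ca * u + cb * s u + cc * s (s u) = be].
Proof.
move=> nz_tu; pose L := wedge t u.
pose ca := s t * s (s u) + s (s t) * s u + al * (s u + s (s u)) + be * (s t + s (s t)).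
pose cb := al * (u + s (s u)) + be * (t + s (s t)) + t * s (s u) + u * s (s t).
pose cc := be * (t + s t) + al * (u + s u) + t * s u + u * s t.
have cramer x y z : ca / L * x + cb / L * y + cc / L * z
    = (ca * x + cb * y + cc * z) / L by ring.
exists (ca / L), (cb / L), (cc / L); rewrite -[ca / L]mulr1 -[cb / L]mulr1.
rewrite -[X in _ + X = 1]mulr1 !mulr1; split.
- rewrite -!mulrDl; apply: (mulIf nz_tu); rewrite mul1r -/L divfK //.
  by rewrite /ca /cb /cc /L /wedge /T /tr !(rmorphD, rmorphM, s3) /=; ring_char2 R2.
- rewrite cramer; apply: (mulIf nz_tu); rewrite -/L divfK //.
  by rewrite /ca /cb /cc /L /wedge /T /tr !(rmorphD, rmorphM, s3) /=; ring_char2 R2.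
- rewrite cramer; apply: (mulIf nz_tu); rewrite -/L divfK //.
  by rewrite /ca /cb /cc /L /wedge /T /tr !(rmorphD, rmorphM, s3) /=; ring_char2 R2.
Qed.

Lemma wedge_basis t u : wedge t u != 0 ->
  forall w, exists x y z, w = i z + (i x * t + i y * u).
Proof.
move=> nz_tu w; pose f (k : K * K * K) := i k.2 + (i k.1.1 * t + i k.1.2 * u).
have f_inj : injective f.
  move=> [[x y] z] [[x' y'] z']; rewrite /f /= => eq_f.
  have [] := @wedge_neq0_independent t u (i (x - x')) (i (y - y')) (i (z - z'))
    (image_fixed _) (image_fixed _) (image_fixed _) nz_tu.
    rewrite !rmorphB; transitivity (i z + (i x * t + i y * u)
      - (i z' + (i x' * t + i y' * u))); first by ring.
    by rewrite eq_f subrr.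
  move=> /eqP + /eqP + /eqP; rewrite !fmorph_eq0 !subr_eq0.
  by move=> /eqP-> /eqP-> /eqP->.
have /codomP[[[x y] z] ->] : w \in codom f.
  by apply: inj_card_onto => //; rewrite !card_prod cardF !expnS expn0 muln1 mulnA.
by exists x, y, z.
Qed.

Hypothesis cub_neq0 : forall w, w != 0 -> cub w != 0.

Lemma lead_neq0 : lead != 0.
Proof. exact/cub_neq0/oner_neq0. Qed.

(** Adding [cub2 t / lead] moves any [t] into the kernel of [cub2] and leaves [wedge] unchanged. For
    [th] not fixed, [th] and [th^2] have a nonzero Vandermonde product. *)
Lemma adapted_basis :
  exists t u, [/\ cub2 t = 0, cub2 u = 0 & wedge t u != 0].
Proof.
have [th nfix] : exists th, s th != th.
  apply/existsP; apply: contraT; rewrite negb_exists => /forallP fix_all.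
  have cardKF : (#|F| <= #|K|)%N.
    have im x : exists k, x = i k by apply/fixed_image/eqP; rewrite -[_ == _]negbK.
    rewrite -(card_codom (fmorph_inj i)) subset_leq_card //.
    by apply/subsetP=> x _; have [k ->] := im x; rewrite codom_f.
  move: cardKF; rewrite cardF cardK -expnM leq_exp2l // ; lia.
have sl : s lead = lead by apply: cubic_fixed.
pose nrm t := t + cub2 t / lead.
have fix_nrm t : s (cub2 t / lead) = cub2 t / lead.
  by rewrite fmorph_div sl [s (cub2 t)](tr_fixed cardF sE).
have cub2_nrm t : cub2 (nrm t) = 0.
  by rewrite cub2_shift // divfK ?lead_neq0 // (addrr_pchar2 F2).
exists (nrm th), (nrm (th ^+ 2)); split=> //.
rewrite wedge_shift // wedge_square !mulf_neq0 // (addr_eq0_pchar2 F2).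
- by rewrite eq_sym.
- by rewrite (inj_eq (fmorph_inj s)) eq_sym.
- by apply: contraNneq nfix => e; rewrite {1}e s3.
Qed.

(** In the basis [1], [t], [u] the form is [lead] times a cubic in [z] without square term, whose
    [xyz] coefficient [wedge t u / lead] is nonzero, so a linear root exists over [F]. *)
Lemma cubic_product_of_lines :
  exists al be ga : F, forall w,
    cub w = lead * nm s (al * w + be * s w + ga * s (s w)).
Proof.
have [t [u [t0 u0 nz_tu]]] := adapted_basis.
have sl : s lead = lead by apply: cubic_fixed.
have sT x : s (T x) = T x by apply: (tr_fixed cardF sE).
have quot_image x : s x = x -> exists k, x / lead = i k.
  by move=> sx; apply: fixed_image; rewrite fmorph_div sx sl.
have [p2 def_p2] : exists k, cub1 t / lead = i k by apply: quot_image; rewrite rmorphD !sT.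
have [p1 def_p1] : exists k, wedge t u / lead = i k by apply: quot_image; rewrite sT.
have [p0 def_p0] : exists k, cub1 u / lead = i k by apply: quot_image; rewrite rmorphD !sT.
have [r3 def_r3] : exists k, cub t / lead = i k by apply: quot_image; rewrite cubic_fixed.
have [r2 def_r2] : exists k, mixed t u / lead = i k by apply: quot_image; rewrite rmorphD !sT.
have [r1 def_r1] : exists k, mixed u t / lead = i k by apply: quot_image; rewrite rmorphD !sT.
have [r0 def_r0] : exists k, cub u / lead = i k by apply: quot_image; rewrite cubic_fixed.
have nz_l := lead_neq0.
pose p x y := p2 * x ^+ 2 + p1 * x * y + p0 * y ^+ 2.
pose r x y := r3 * x ^+ 3 + r2 * x ^+ 2 * y + r1 * x * y ^+ 2 + r0 * y ^+ 3.
have cubE x y z : cub (i z + (i x * t + i y * u)) = lead * i (z ^+ 3 + p x y * z + r x y).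
  rewrite cubic_shift ?image_fixed // cub2_comb ?image_fixed // t0 u0.
  rewrite cub1_comb ?image_fixed // cub_comb ?image_fixed //.
  rewrite /p /r !(rmorphD, rmorphM, rmorphXn) /=.
  rewrite -def_p2 -def_p1 -def_p0 -def_r3 -def_r2 -def_r1 -def_r0; field; exact: nz_l.
have no_zero x y z : (x, y) != (0, 0) -> z ^+ 3 + p x y * z + r x y != 0.
  move=> nz_xy; have: cub (i z + (i x * t + i y * u)) != 0.
    apply: cub_neq0; apply: contraNneq nz_xy => zero.
    have [x0 y0 _] := wedge_neq0_independent (image_fixed x) (image_fixed y)
      (image_fixed z) nz_tu zero.
    by rewrite xpair_eqE -!(fmorph_eq0 i) x0 y0 eqxx.
  by rewrite cubE mulf_eq0 negb_or fmorph_eq0 => /andP[].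
have nz_p1 : p1 != 0 by rewrite -(fmorph_eq0 i) -def_p1 mulf_neq0 ?invr_eq0.
have [al [be lin_root]] := ternary_cubic_linear_root i cardK n_gt1 cardF nz_p1 no_zero.
have [ca [cb [cc [lin1 lint linu]]]] := line_interpolation al be nz_tu.
exists ca, cb, cc => w; have [x [y [z ->]]] := wedge_basis nz_tu w.
pose v := al * i x + be * i y.
have -> : ca * (i z + (i x * t + i y * u)) + cb * s (i z + (i x * t + i y * u))
    + cc * s (s (i z + (i x * t + i y * u))) = i z + v.
  transitivity ((ca + cb + cc) * i z + (ca * t + cb * s t + cc * s (s t)) * i x
    + (ca * u + cb * s u + cc * s (s u)) * i y).
    by rewrite !(rmorphD, rmorphM, image_fixed) /=; ring.
  by rewrite lin1 lint linu /v; ring.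
have sv1 : s (i z + v) = i z + s v by rewrite rmorphD image_fixed.
have sv2 : s (i z + s v) = i z + s (s v) by rewrite rmorphD image_fixed.
rewrite cubE; congr (_ * _); rewrite /nm sv1 sv2 {sv1 sv2}.
(* At the origin the cubic is [z^3], which is not rootless. *)
have [xy0|nz_xy] := eqVneq (x, y) (0, 0).
  have [-> ->] := xy0; have -> : p 0 0 = 0 by rewrite /p; ring.
  have -> : r 0 0 = 0 by rewrite /r; ring.
  have -> : v = 0 by have [x0 y0] := xy0; rewrite /v x0 y0 !rmorph0; ring.
  by rewrite !rmorph0 mul0r !addr0 rmorphXn; ring.
have rt_v : v ^+ 3 + i (p x y) * v + i (r x y) = 0.
  by rewrite -(lin_root (i x) (i y) v) // /p /r !(rmorphD, rmorphM, rmorphXn).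
(* The roots in [z] are [v] and its conjugates, so the cubic is the norm of [i z + v]. *)
have [] := rootless_cubic_roots cardK (fun k => no_zero x y k nz_xy) rt_v.
rewrite -!sE => v2 _ def_p def_r.
rewrite [i (_ + r x y)]rmorphD [i (_ + p x y * z)]rmorphD [i (p x y * z)]rmorphM.
by rewrite rmorphXn def_p def_r v2; ring_char2 R2.
Qed.

End Factorization.

(** The norm is multiplicative and invariant under [s]: a nonzero coefficient is rotated to the
    front and factored out. *)
Lemma norm_line_normalize (F : finFieldType) (s : {rmorphism F -> F}) (al be ga : F) :
  (forall x, s (s (s x)) = x) -> (al, be, ga) != (0, 0, 0) ->
  exists k U V, forall w,
    nm s (al * w + be * s w + ga * s (s w)) = k * nm s (line s U V w).
Proof.
move=> s3 nz.
have nm_s x : nm s (s x) = nm s x by rewrite /nm s3; ring.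
have nmM x y : nm s (x * y) = nm s x * nm s y by rewrite /nm !rmorphM; ring.
have base a b c : a != 0 -> exists k U V, forall w,
    nm s (a * w + b * s w + c * s (s w)) = k * nm s (line s U V w).
  move=> nz_a; exists (nm s a), (b / a), (c / a) => w.
  by rewrite -nmM /line; congr (nm s _); field.
have [al0|/base//] := eqVneq al 0.
have [be0|nz_be] := eqVneq be 0.
  have nz_ga : s ga != 0 by move: nz; rewrite al0 be0 !xpair_eqE !eqxx fmorph_eq0.
  have [k [U [V kUV]]] := base _ (s al) (s be) nz_ga; exists k, U, V => w.
  by rewrite -kUV -nm_s !rmorphD !rmorphM s3; congr (nm s _); ring.
have nz_sbe : s (s be) != 0 by rewrite !fmorph_eq0.
have [k [U [V kUV]]] := base _ (s (s ga)) (s (s al)) nz_sbe; exists k, U, V => w.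
by rewrite -kUV -nm_s -[LHS]nm_s !rmorphD !rmorphM !s3; congr (nm s _); ring.
Qed.

Theorem theorem1 :
  exists m0 : nat, forall m : nat, (m0 <= m)%N ->
  forall (F : finFieldType), #|F| = (2 ^ (3 * m))%N ->
  forall a b c : F,
    planar (P2 (2 ^ m)%N a b c) <->
    exists u v : F,
      Delta (2 ^ m)%N u v != 1 /\
      (a, b, c) =
      ((v ^+ (2 ^ m)%N + u ^+ ((2 ^ m) + (2 ^ m) ^ 2)%N
          + u ^+ ((2 ^ m) ^ 2)%N * v ^+ (1 + 2 ^ m)%N) / (1 + Delta (2 ^ m)%N u v),
       (u ^+ ((2 ^ m) ^ 2)%N * v ^+ (2 ^ m)%N) / (1 + Delta (2 ^ m)%N u v),
       (v ^+ ((2 ^ m) + (2 ^ m) ^ 2)%N + u ^+ ((2 ^ m) ^ 2)%N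
          + u ^+ (1 + (2 ^ m) ^ 2)%N * v ^+ (2 ^ m)%N) / (1 + Delta (2 ^ m)%N u v)).
Proof.
(* With [m = n + 2] this gives [2^n >= 4], as the degree comparison in [trace_form_wronskian]
   requires. *)
exists 4%N => m m_ge4 F cardF2 a b c.
have [|K [i [s [cardK sE]]]] := subfield_frobenius _ cardF2; first by lia.
have cardF : #|F| = (#|K| ^ 3)%N by rewrite cardF2 cardK -expnM mulnC.
rewrite -cardK in sE *; set q := #|K| in sE *.
have F2 : 2%N \in [pchar F] := image_pchar2 i cardK.
have q_gt3 : (3 < q)%N.
  by rewrite /q cardK (leq_trans _ (_ : 2 ^ 2 <= _)%N) // leq_exp2l //; lia.
have [n def_m] : exists n, m = n.+2 by exists m.-2; lia.
have n_gt1 : (1 < n)%N by lia.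
have s3 := frob3 cardF sE; have sqq := frob_square_field sE.
have numE (u v : F) : [/\ v ^+ q + u ^+ (q + q ^ 2) + u ^+ (q ^ 2) * v ^+ (1 + q) = numa s u v,
    u ^+ (q ^ 2) * v ^+ q = numb s u v &
    v ^+ (q + q ^ 2) + u ^+ (q ^ 2) + u ^+ (1 + q ^ 2) * v ^+ q = numc s u v].
  by rewrite !exprD !sqq -!sE expr1.
rewrite (planar_cubic F2 cardF q_gt3 sE).
split=> [cub_neq0 | [u [v [nz_D]]] + w nz_w]; last first.
  (* Up to the factor [d^2] the cubic form is the norm of a line without nontrivial zeros. *)
  have [-> -> ->] := numE u v; case=> -> -> ->.
  have nz_line : line s (u ^+ 2) (v ^+ 2) w != 0.
    by apply: contraNneq nz_w => /(line_eq0 F2 cardF sE nz_D)->.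
  have := nm_neq0 s nz_line; rewrite -(cubic_line F2 cardF sE w nz_D).
  by rewrite mulf_eq0 negb_or => /andP[].
rewrite def_m in cardK.
have [al [be [ga cub_lines]]] := cubic_product_of_lines i cardK n_gt1 cardF sE cub_neq0.
have nz_abc : (al, be, ga) != (0, 0, 0).
  apply: contraNneq (cub_neq0 1 (oner_neq0 _)) => -[al0 be0 ga0].
  by rewrite cub_lines al0 be0 ga0 !mul0r !addr0 /nm !mul0r mulr0.
have [k [U [V kUV]]] := norm_line_normalize s3 nz_abc.
have [|u [v [nz_D def_abc]]] := @cubic_line_coefs F q s F2 cardF q_gt3 sE a b c
    (cubic s a b c 1 * k) U V; first by move=> w; rewrite cub_lines kUV mulrA.
by exists u, v; have [-> -> ->] := numE u v.
Qed.
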